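(* Let $\tau$ be a topology on a finite set $X_n$ with $n$ elements. The open set polynomial $\sum_{j=0}^{n}u_jx^j$ of $\tau$ has only real zeros if and only if $\tau$ is the discrete topology on $X_n$.
   Context: For a topology $\tau$ on a finite set $X_n$ with $n$ elements, $u_j$ denotes the number of open sets in $\tau$ having cardinality $j$ ($0\le j\le n$; the empty set and $X_n$ are counted, so $u_0=u_n=1$). The open set polynomial (open polynomial) of $\tau$ is $P(x)=\sum_{j=0}^{n}u_jx^j$. *)

(* Defs.v *)
From mathcomp Require Import all_boot all_order all_algebra finmap.
From mathcomp Require Import all_classical reals topology complex.

Set Implicit Arguments.
Unset Strict Implicit.
Unset Printing Implicit Defensive.

Import Order.TTheory GRing.Theory Num.Theory.

Local Open Scope classical_set_scope.
Local Open Scope card_scope.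
Local Open Scope ring_scope.

(* [fset_set] is [fset0] on infinite sets, so this is a genuine count only
   when there are finitely many such open sets, e.g. when [X] is finite. *)
Definition nb_open (X : topologicalType) (j : nat) : nat :=
  #|` fset_set [set U : set X | open U /\ U #= `I_j] |%fset.

Definition open_poly (F : nzRingType) (X : topologicalType) (n : nat) :
    {poly F} :=
  \poly_(j < n.+1) (nb_open X j)%:R.

(* For a complex number, [Num.real] means zero imaginary part. *)
Definition only_real_zeros (R : realType) (p : {poly R[i]}) : Prop :=
  forall z : R[i], root p z -> z \is Num.real.

Definition is_discrete (X : topologicalType) : Prop :=
  @open X = [set: set X].

(* Main.v *)
Require Import Defs.
From mathcomp Require Import all_boot all_order all_algebra finmap.
From mathcomp Require Import all_classical reals topology complex.

(** Let [p] be the open set polynomial of a space with [n] points. It is monic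
of degree [n] and [p(0) = 1], because the whole space and the empty set are
open. Its coefficients being nonnegative, a real zero [z] of [p] is negative.

If all zeros are real, the [n] numbers [- z^-1] are therefore positive; their
product is [1 / p(0) = 1] and their sum is [p'(0) / p(0)], the number of open
singletons. The inequality of arithmetic and geometric means
([size_le_coef1_prod_XsubC]) bounds this sum below by [n]. Since the space has
only [n] singletons, all of them are open and the topology is discrete
([discrete_of_nb_open1]).

Conversely, in a discrete space every set is open, so [p] is [(1 + 'X) ^+ n]
by the binomial formula ([open_poly_discrete]), whose only possible zero
is [- 1]. *)

Import Order.TTheory GRing.Theory Num.Theory.

Local Open Scope classical_set_scope.
Local Open Scope card_scope.
Local Open Scope ring_scope.

(** This is the logarithmic derivative at [0]: for a product [p] of linear
factors, [p' / p] is the sum of the [('X - z)^-1], and [p'(0)] is [p`_1]. *)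
Lemma coef1_prod_XsubC (F : fieldType) (r : seq F) :
  (forall z, z \in r -> z != 0) ->
  (\prod_(z <- r) ('X - z%:P))`_1 =
  (\prod_(z <- r) ('X - z%:P))`_0 * \sum_(z <- r) - z^-1.
Proof.
elim: r => [|a r IH] r0; first by rewrite !big_nil coefC mulr0.
have a0 : a != 0 by apply: r0; rewrite mem_head.
rewrite !big_cons mulrBl !coefB !coefXM !coefCM /= IH; last first.
  by move=> z zr; apply: r0; rewrite inE zr orbT.
by rewrite sub0r mulNr mulrDr opprD mulrN opprK mulrAC divff // mul1r mulrA.
Qed.

(** The numbers [- z^-1] are positive, and their product is the inverse of the
constant coefficient, hence [1]; so their arithmetic mean is at least [1].
Their sum is the coefficient of degree one. *)
Lemma size_le_coef1_prod_XsubC (F : numFieldType) (r : seq F) :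
  (forall z, z \in r -> z < 0) -> (\prod_(z <- r) ('X - z%:P))`_0 = 1 ->
  (size r)%:R <= (\prod_(z <- r) ('X - z%:P))`_1.
Proof.
move=> r_lt0 p0.
rewrite coef1_prod_XsubC => [|z /r_lt0 /ltr0_neq0//]; rewrite p0 mul1r.
have [->|r_gt0] := posnP (size r).
  rewrite big_seq sumr_ge0 // => z /r_lt0.
  by rewrite oppr_ge0 invr_le0 => /ltW.
have prodV : \prod_(z <- r) (- z^-1) = 1.
  move: p0; rewrite -horner_coef0 horner_prod => p0.
  rewrite -[RHS]invr1 -[in RHS]p0 -prodfV.
  by apply: eq_bigr => z _; rewrite !hornerE invrN.
pose E (i : 'I_(size r)) := - (r`_i)^-1.
have E_ge0 : {in 'I_(size r), forall i, 0 <= E i}.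
  by move=> i _; rewrite oppr_ge0 invr_le0 ltW // r_lt0 // mem_nth.
have [+ _] := leif_AGM E_ge0.
have -> : \prod_(i in 'I_(size r)) E i = 1.
  by rewrite -[RHS]prodV (big_nth 0) big_mkord.
have -> : \sum_(i in 'I_(size r)) E i = \sum_(z <- r) (- z^-1).
  by rewrite (big_nth 0) big_mkord.
have sum_ge0 : 0 <= \sum_(z <- r) (- z^-1).
  rewrite (big_nth 0) big_mkord; apply: sumr_ge0 => i _; exact: E_ge0.
rewrite card_ord expr_ge1 ?divr_ge0 ?ler0n //.
by rewrite ler_pdivlMr ?ltr0n // mul1r.
Qed.

(** At a nonnegative point every term of [p] is nonnegative, so the value of [p]
is at least [p`_0]. *)
Lemma real_root_lt0_of_coef_ge0 (F : numFieldType) (p : {poly F}) (z : F) :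
  (forall j, 0 <= p`_j) -> 0 < p`_0 -> z \is Num.real -> root p z -> z < 0.
Proof.
move=> p_ge0 p0 zR; apply: contraLR; rewrite -real_leNgt ?real0 // => z_ge0.
rewrite /root gt_eqF // (lt_le_trans p0) // horner_coef.
have : (0 < size p)%N.
  by rewrite lt0n size_poly_eq0; apply: contraTneq p0 => ->; rewrite coef0 ltxx.
case: (size p) => // k _.
rewrite big_ord_recl expr0 mulr1 lerDl sumr_ge0 // => i _.
by rewrite mulr_ge0 ?exprn_ge0.
Qed.

Lemma card_set_finset (T : finType) (A : {set T}) : [set` A] #= `I_#|A|.
Proof.
have -> : [set` A] = [set` [fset x in A]%fset].
  by apply/seteqP; split => x /=; rewrite !inE.
by apply/card_eq_fsetP; rewrite card_finset.
Qed.

Lemma subset_leq_card_fset_set (T : choiceType) (A B : set T) :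
  finite_set B -> A `<=` B -> (#|` fset_set B| <= #|` fset_set A|)%N -> A = B.
Proof.
move=> finB AB BA; have finA := sub_finite_set AB finB.
apply: fset_set_inj; rewrite ?inE //; apply/eqP.
by rewrite eqEfcard BA andbT; rewrite fset_set_sub in AB.
Qed.

Lemma exists_ord_bij (T : Type) (n : nat) (T_card : [set: T] #= `I_n) :
  exists2 f : T -> 'I_n, injective f & forall i, exists x, f x = i.
Proof.
have [g [gf gi gs]] := card_set_bijP T_card.
exists (fun x => Ordinal (gf x Logic.I)).
  by move=> x y /(congr1 val) /= /gi; apply; rewrite inE.
by move=> i; have [x _ gx] := gs i (ltn_ord i); exists x; apply: val_inj.
Qed.

(** A numbering of [T] by ['I_n] turns the sets of [T] of cardinality [j]
into the finite sets counted by [card_draws]. *)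
Lemma card_sets_of_card (T : Type) (n : nat) (T_card : [set: T] #= `I_n) j :
  [set U : set T | U #= `I_j] #= `I_('C(n, j)).
Proof.
have [f f_inj f_surj] := exists_ord_bij _ _ T_card.
pose F (A : {set 'I_n}) : set T := [set x | f x \in A].
have fF A : f @` F A = [set` A].
  apply/seteqP; split => [_ [x xA <-]//|i iA] /=.
  by have [x fx] := f_surj i; exists x => //; rewrite /F /= fx.
have F_inj : injective F.
  move=> A B AB; have := fF A; rewrite AB fF => /seteqP[BsubA AsubB].
  by apply/setP => i; apply/idP/idP; [apply: AsubB|apply: BsubA].
have F_card A : F A #= `I_#|A|.
  apply: card_eq_trans (card_set_finset _ A); rewrite -fF card_eq_sym.
  by apply: inj_card_eq => x y _ _; apply: f_inj.
(* The finite set sent to [U] is the direct image of [U] by [f]. *)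
have F_surj U : F [set i | `[< exists2 x, U x & f x = i >]]%SET = U.
  apply/seteqP; split => x; rewrite /F /= inE; last first.
    by move=> Ux; apply/asboolP; exists x.
  by move=> /asboolP[y Uy /f_inj <-].
have -> : [set U : set T | U #= `I_j] =
    F @` [set` [set A : {set 'I_n} | #|A| == j]%SET].
  apply/seteqP; split => [U /= Uj|_ [A /= + <-]]; last first.
    by rewrite inE => /eqP <-.
  exists [set i | `[< exists2 x, U x & f x = i >]]%SET; last exact: F_surj.
  rewrite /= inE; apply/eqP/card_eq_II/(card_eq_trans _ Uj).
  by rewrite card_eq_sym -{1}[U]F_surj F_card.
apply: card_eq_trans (inj_card_eq _) _; first by move=> ? ? _ _; apply: F_inj.
have := card_set_finset _ [set A : {set 'I_n} | #|A| == j]%SET.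
by rewrite card_draws card_ord.
Qed.

Lemma eq_setT_of_card (T : choiceType) (n : nat) (T_card : [set: T] #= `I_n)
    (U : set T) : U #= `I_n -> U = setT.
Proof.
move=> Un; apply: subset_leq_card_fset_set => //; first by exists n.
by rewrite (card_fset_set T_card) (card_fset_set Un).
Qed.

Lemma nb_open0 (X : topologicalType) : nb_open X 0 = 1%N.
Proof.
rewrite /nb_open (_ : mkset _ = [set set0]) ?fset_set1 ?cardfs1 //.
apply/seteqP; split => [U /= [_]|_ -> /=]; rewrite II0.
  by rewrite card_eq0 => /eqP.
by split; [exact: open0|].
Qed.

Lemma nb_open_card (n : nat) (X : topologicalType)
    (X_card : [set: X] #= `I_n) :
  nb_open X n = 1%N.
Proof.
rewrite /nb_open (_ : mkset _ = [set setT]) ?fset_set1 ?cardfs1 //.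
apply/seteqP; split => [U /= [_ /(eq_setT_of_card _ _ X_card)]|_ -> /=] //.
by split; [exact: openT|].
Qed.

Lemma nb_open_discrete (n : nat) (X : topologicalType)
    (X_card : [set: X] #= `I_n) j :
  is_discrete X -> nb_open X j = 'C(n, j).
Proof.
move=> Xd; rewrite -(card_fset_set (card_sets_of_card _ _ X_card j)) /nb_open.
by congr #|` fset_set _|; apply/seteqP; split => U /= => [[]|] //; rewrite Xd.
Qed.

(** There are exactly [n] singletons, so [n] open ones means that all are
open, and every set is a union of singletons. *)
Lemma discrete_of_nb_open1 (n : nat) (X : topologicalType)
    (X_card : [set: X] #= `I_n) :
  (n <= nb_open X 1)%N -> is_discrete X.
Proof.
have S_card := card_sets_of_card _ _ X_card 1; rewrite bin1 in S_card.
move=> n_le; have open_singletons :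
    [set U : set X | open U /\ U #= `I_1] = [set U | U #= `I_1].
  apply: subset_leq_card_fset_set; first by exists n.
    by move=> U [].
  by rewrite (card_fset_set S_card).
apply/seteqP; split => // U _.
rewrite -[U]image_id -bigcup_imset1.
apply: bigcup_open => x _.
have : [set U : set X | U #= `I_1] [set x] by exact: card_set1.
by rewrite -open_singletons => -[].
Qed.

Lemma open_poly_discrete (F : nzRingType) (n : nat) (X : topologicalType)
    (X_card : [set: X] #= `I_n) :
  is_discrete X -> open_poly F X n = (1 + 'X) ^+ n.
Proof.
move=> Xd; rewrite exprDn_comm; last exact/commr_sym/commr1.
rewrite /open_poly poly_def; apply: eq_bigr => j _.
by rewrite expr1n mul1r (nb_open_discrete _ _ X_card) // scaler_nat.
Qed.

Theorem theorem2p1 (R : realType) (n : nat) (X : topologicalType)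
    (X_card : [set: X] #= `I_n) :
  only_real_zeros (open_poly R[i] X n) <-> is_discrete X.
Proof.
split=> [real_zeros|Xd z]; last first.
  rewrite open_poly_discrete // /root horner_exp expf_eq0 => /andP[_].
  by rewrite !hornerE addr_eq0 eq_sym eqr_oppLR => /eqP->;
    rewrite rpredN real1.
apply: (discrete_of_nb_open1 _ _ X_card).
set p := open_poly _ _ _ in real_zeros.
have p_coef j : (j <= n)%N -> p`_j = (nb_open X j)%:R.
  by move=> jn; rewrite coef_poly ltnS jn.
have p0 : p`_0 = 1 by rewrite p_coef // nb_open0.
have p_ge0 j : 0 <= p`_j by rewrite coef_poly; case: ifP => // _; exact: ler0n.
have pn : p`_n = 1 by rewrite p_coef // (nb_open_card _ _ X_card).
have size_p : size p = n.+1.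
  apply/eqP; rewrite eqn_leq size_poly ltnNge /=.
  apply: contra_eqN pn => /leq_sizeP/(_ n (leqnn n)) ->.
  by rewrite eq_sym oner_eq0.
have p_monic : lead_coef p = 1 by rewrite lead_coefE size_p.
have [r p_prod] := closed_field_poly_normal p.
rewrite p_monic scale1r in p_prod.
have size_r : size r = n.
  by move: size_p; rewrite p_prod size_prod_XsubC => -[].
have r_lt0 z : z \in r -> z < 0.
  move=> zr; have pz : root p z by rewrite p_prod root_prod_XsubC.
  apply: (@real_root_lt0_of_coef_ge0 _ p) => //; first by rewrite p0 ltr01.
  exact: real_zeros.
have [n0|n_gt0] := posnP n; first by rewrite [leqLHS]n0.
rewrite -(ler_nat R[i]) -(p_coef 1%N) // -size_r p_prod.
by apply: size_le_coef1_prod_XsubC; rewrite -?p_prod.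
Qed.
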